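(* For all $d,k\in\mathbb{N}$, all topologies $G,G'$, all process templates $P\in\mathcal{P}_u$, all $k$-tuples $\bar g$ of distinct vertices of $G$ and all $k$-tuples $\bar g'$ of distinct vertices of $G'$: if $T(G,\bar g)\equiv_{\mathsf{CTL}^*_d\setminus\mathsf{X}}T(G',\bar g')$, then $P^G|_{\bar g}\equiv_{\mathsf{CTL}^*_d\setminus\mathsf{X}}P^{G'}|_{\bar g'}$.
   Context: A process template $P\in\mathcal{P}_u$ is a finite LTS over atoms $\mathsf{AP}_{pr}$ with action labels $\Sigma_{int}\cup\{\mathsf{snd},\mathsf{rcv}\}$ ($\Sigma_{int}$ finite nonempty), states partitioned into nonempty token states $T$ and non-token states $N$, initial states $\{\iota_t,\iota_n\}$ with $\iota_t\in T,\iota_n\in N$, $\mathsf{snd}$-transitions from $T$ to $N$, $\mathsf{rcv}$-transitions from $N$ to $T$, internal transitions staying within $T$ or within $N$, every state having a successor, and every infinite action sequence in $(\Sigma_{int}^*\mathsf{snd}\Sigma_{int}^*\mathsf{rcv})^\omega\cup(\Sigma_{int}^*\mathsf{rcv}\Sigma_{int}^*\mathsf{snd})^\omega$. A topology is $G=(V,E,x)$, $V=[n]$, $x\in V$ initial, $E\subseteq V\times V$ irreflexive. The token-passing system $P^G$ has states $Q^V$, initial state with $x$ in $\iota_t$ and all other vertices in $\iota_n$, labeling $p_i$ iff $p$ holds in the local state of $i$, internal transitions (one vertex takes an internal local transition, others unchanged) and token-passing transitions along edges $(v,w)\in E$ ($v$ takes an $\mathsf{snd}$ local transition and $w$ a $\mathsf{rcv}$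 local transition simultaneously, others unchanged). Projection $P^G|_{\bar g}$: the LTS $P^G$ relabeled by $L(s)=\{p@i:p_{g_i}\in\Lambda(s),i\in[k]\}$. Graph LTS $T(G,\bar g)$: states $V$, initial state $x$, one action, transitions exactly the edges of $G$, label $\{i\}$ at $g_i$ and $\emptyset$ elsewhere. $\mathsf{CTL}^*_d\setminus\mathsf{X}$ is $\mathsf{CTL}^*$ without the next-time operator with path-quantifier nesting depth at most $d$; $M\equiv_{\mathsf{CTL}^*_d\setminus\mathsf{X}}N$ means $M$ and $N$ (from their initial states) satisfy the same such formulas. *)

(* Defs.v *)
From mathcomp Require Import all_boot.

Set Implicit Arguments.
Unset Strict Implicit.
Unset Printing Implicit Defensive.

(* Labelled transition systems with states [S] and actions [A], over the
   atoms [AP].  The transition relation need not be total. *)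
Record lts (S A AP : Type) : Type := LTS {
  init : S -> Prop;
  trans : S -> A -> S -> Prop;
  label : S -> AP -> Prop
}.

(* CTL* without the next-time operator.  The remaining connectives are the
   usual abbreviations, e.g. A phi := ~ E ~ phi and F phi := true U phi.
   [STrue] is primitive because [AP] may be empty. *)
Inductive sform (AP : Type) : Type :=
| STrue
| SAtom of AP
| SNot of sform AP
| SAnd of sform AP & sform AP
| SE of pform AP
with pform (AP : Type) : Type :=
| PState of sform AP
| PNot of pform AP
| PAnd of pform AP & pform AP
| PUntil of pform AP & pform AP.

Arguments STrue {AP}.

Fixpoint sdepth (AP : Type) (f : sform AP) : nat :=
  match f with
  | STrue => 0
  | SAtom _ => 0
  | SNot f1 => sdepth f1
  | SAnd f1 f2 => maxn (sdepth f1) (sdepth f2)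
  | SE p => (pdepth p).+1
  end
with pdepth (AP : Type) (p : pform AP) : nat :=
  match p with
  | PState f => sdepth f
  | PNot p1 => pdepth p1
  | PAnd p1 p2 => maxn (pdepth p1) (pdepth p2)
  | PUntil p1 p2 => maxn (pdepth p1) (pdepth p2)
  end.

Definition infinite_path (S A AP : Type) (M : lts S A AP) (pi : nat -> S) :
    Prop :=
  forall i, exists a, trans M (pi i) a (pi i.+1).

Definition suffix (S : Type) (pi : nat -> S) (i : nat) : nat -> S :=
  fun j => pi (i + j).

(* Path quantifiers range over infinite paths, so that no formula [SE p] holds
   in a state from which no infinite path starts. *)
Fixpoint ssat (S A AP : Type) (M : lts S A AP) (s : S) (f : sform AP) : Prop :=
  match f with
  | STrue => True
  | SAtom a => label M s a
  | SNot f1 => ~ ssat M s f1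
  | SAnd f1 f2 => ssat M s f1 /\ ssat M s f2
  | SE p => exists pi, [/\ infinite_path M pi, pi 0 = s & psat M pi p]
  end
with psat (S A AP : Type) (M : lts S A AP) (pi : nat -> S) (p : pform AP) :
    Prop :=
  match p with
  | PState f => ssat M (pi 0) f
  | PNot p1 => ~ psat M pi p1
  | PAnd p1 p2 => psat M pi p1 /\ psat M pi p2
  | PUntil p1 p2 => exists j, psat M (suffix pi j) p2 /\
                      forall i, i < j -> psat M (suffix pi i) p1
  end.

Definition models (S A AP : Type) (M : lts S A AP) (f : sform AP) : Prop :=
  forall s, init M s -> ssat M s f.

Definition ctls_equiv (d : nat) (AP S A S' A' : Type)
    (M : lts S A AP) (M' : lts S' A' AP) : Prop :=
  forall f : sform AP, sdepth f <= d -> (models M f <-> models M' f).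

Inductive action (Sint : Type) : Type :=
| Int of Sint
| Snd
| Rcv.

Arguments Snd {Sint}.
Arguments Rcv {Sint}.

Definition is_int (Sint : Type) (a : action Sint) : bool :=
  if a is Int _ then true else false.

Definition omega_power (A : Type) (L : seq A -> Prop) (alpha : nat -> A) :
    Prop :=
  exists c : nat -> nat,
    [/\ c 0 = 0,
        forall i, c i < c i.+1
      & forall i, L [seq alpha j | j <- iota (c i) (c i.+1 - c i)]].

(* The language (Sint^* a Sint^* b). *)
Definition block (Sint : Type) (a b : action Sint) (w : seq (action Sint)) :
    Prop :=
  exists u v, [/\ all (@is_int Sint) u, all (@is_int Sint) v
                & w = u ++ a :: v ++ [:: b]].

(* Token states are those in [token], non-token states those outside. *)
Record template (Sint : finType) (AP : Type) : Type := Template {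
  pstate : finType;
  plts :> lts pstate (action Sint) AP;
  token : pred pstate;
  iota_t : pstate;
  iota_n : pstate;
  iota_tP : token iota_t;
  iota_nP : ~~ token iota_n;
  initP : forall q, init plts q <-> q = iota_t \/ q = iota_n;
  sndP : forall q q', trans plts q Snd q' -> token q /\ ~~ token q';
  rcvP : forall q q', trans plts q Rcv q' -> ~~ token q /\ token q';
  intP : forall q a q', trans plts q (Int a) q' -> token q = token q';
  totalP : forall q, exists a q', trans plts q a q';
  alternateP : forall (q : nat -> pstate) (alpha : nat -> action Sint),
    (forall i, trans plts (q i) (alpha i) (q i.+1)) ->
    omega_power (block Snd Rcv) alpha \/ omega_power (block Rcv Snd) alpha
}.

Record topology : Type := Topology {
  size_of : nat;
  edge : rel 'I_size_of;
  start : 'I_size_of;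
  edge_irr : irreflexive edge
}.

Notation vertex G := 'I_(size_of G).

Inductive sys_action (Sint : Type) : Type :=
| SysInt of Sint
| SysTok.

Definition sys_trans (Sint : finType) (AP : Type) (P : template Sint AP)
    (G : topology) (s : {ffun vertex G -> pstate P}) (a : sys_action Sint)
    (s' : {ffun vertex G -> pstate P}) : Prop :=
  match a with
  | SysInt b => exists v : vertex G,
      trans P (s v) (Int b) (s' v) /\ forall u, u != v -> s' u = s u
  | SysTok => exists v w : vertex G,
      [/\ edge v w, trans P (s v) Snd (s' v), trans P (s w) Rcv (s' w)
        & forall u, u != v -> u != w -> s' u = s u]
  end.

(* The token-passing system P^G; the atom (p, v) stands for p_v. *)
Definition tps (Sint : finType) (AP : Type) (P : template Sint AP)
    (G : topology) :
    lts {ffun vertex G -> pstate P} (sys_action Sint) (AP * vertex G) :=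
  {| init := fun s =>
       s = [ffun v => if v == start G then iota_t P else iota_n P];
     trans := @sys_trans Sint AP P G;
     label := fun s pv => label P (s pv.2) pv.1 |}.

(* P^G|_g; the atom (p, i) stands for p@i. *)
Definition projection (Sint : finType) (AP : Type) (P : template Sint AP)
    (G : topology) (k : nat) (g : k.-tuple (vertex G)) :
    lts {ffun vertex G -> pstate P} (sys_action Sint) (AP * 'I_k) :=
  {| init := init (tps P G);
     trans := trans (tps P G);
     label := fun s pi => label (tps P G) s (pi.1, tnth g pi.2) |}.

Definition graph_lts (G : topology) (k : nat) (g : k.-tuple (vertex G)) :
    lts (vertex G) unit 'I_k :=
  {| init := fun v => v = start G;
     trans := fun v _ w => edge v w;
     label := fun v i => v = tnth g i |}.

(* Main.v *)
Require Import Defs.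
From mathcomp Require Import all_boot.
From mathcomp Require Import zify.
From Stdlib Require Import Classical ClassicalEpsilon.
From Stdlib Require Import Relation_Operators Operators_Properties.

(* Two infinite paths satisfy the same path formulas of depth [d] as soon as
   they can be walked through simultaneously, each side advancing by at most
   one position at a time, so that the current states always agree on state
   formulas of depth [d].  On finite graphs the converse also holds: the classes
   of states modulo depth-[d] formulas have characteristic formulas, every finite
   sequence of classes is expressible by nested untils, and Koenig's lemma glues
   the resulting finite paths into an infinite one.

   In a token-passing system the token moves infinitely often on every infinite
   path, since no template has an infinite internal run; its trajectory is thus a
   path of the graph up to stuttering.  States of [P^G] and [P^G'] are related
   when the token holders agree on depth-[d] formulas of the graphs and the
   visible processes have the same local states.  A path of [P^G] is simulated
   by letting the token of [P^G'] follow a graph path matched with the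
   trajectory: visible processes copy their counterparts, and the others run
   internally, which is invisible, until they can send or receive. *)

Set Implicit Arguments.
Unset Strict Implicit.
Unset Printing Implicit Defensive.

(** * Alignment of infinite paths *)

Lemma functional_choice_eps (A B : Type) (r : A -> B -> Prop) :
  (forall a, exists b, r a b) -> exists f : A -> B, forall a, r a (f a).
Proof.
move=> H; exists (fun a => proj1_sig (constructive_indefinite_description _ (H a))).
by move=> a; case: constructive_indefinite_description.
Qed.

Lemma dependent_choice_inv (X : Type) (I : X -> Prop) (r : X -> X -> Prop) :
  (forall x, I x -> exists y, r x y /\ I y) ->
  forall x, I x ->
  exists xs : nat -> X, xs 0 = x /\ forall n, r (xs n) (xs n.+1) /\ I (xs n).
Proof.
move=> H x Ix.
have H' (y : {y | I y}) : exists z : {z | I z}, r (proj1_sig y) (proj1_sig z).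
  by case: y => y Iy; case: (H y Iy) => z [ryz Iz]; exists (exist _ z Iz).
have [f Hf] := functional_choice_eps H'.
exists (fun n => proj1_sig (iter n f (exist _ x Ix))); split=> // n.
by split; [exact: Hf | exact: proj2_sig].
Qed.

Lemma pigeonhole_decreasing (T : finType) (Q : nat -> T -> Prop) :
  (forall m u, Q m.+1 u -> Q m u) -> (forall m, exists u, Q m u) ->
  exists u, forall m, Q m u.
Proof.
move=> Qdec Qex; apply: NNPP => no.
have Qle m n u : m <= n -> Q n u -> Q m u.
  by move=> /subnK <-; elim: (n - m) => [//|k IH]; rewrite addSn => /Qdec.
have H u : exists m, ~ Q m u.
  by apply: NNPP => H; apply: no; exists u => m; apply: NNPP => nQ; apply: H; exists m.
have [b Hb] := functional_choice_eps H.
have [u Qu] := Qex (\max_u b u).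
by apply: (Hb u); apply: Qle Qu; exact: leq_bigmax.
Qed.

(** Unit steps and unboundedness make [f] surjective, so a walk paced by [f] may wait but skips no
    position. *)
Definition pace (f : nat -> nat) : Prop :=
  [/\ f 0 = 0, forall n, f n.+1 = f n \/ f n.+1 = (f n).+1
    & forall m, exists n, m <= f n].

Lemma step_mono (f : nat -> nat) :
  (forall n, f n.+1 = f n \/ f n.+1 = (f n).+1) -> {homo f : m n / m <= n}.
Proof.
move=> fS; apply: homo_leq => // [m n p|n]; first exact: leq_trans.
by have [->|->] := fS n.
Qed.

Lemma pace_mono (f : nat -> nat) : pace f -> {homo f : m n / m <= n}.
Proof. by case=> _ fS _; exact: step_mono. Qed.

Lemma pace_first (f : nat -> nat) j : pace f ->
  exists m, f m = j /\ forall n, n < m -> f n < j.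
Proof.
move=> [f0 fS fU]; have exj : exists n, j <= f n by exact: fU.
have [m mP mmin] := ex_minnP exj.
have mlt n : n < m -> f n < j.
  by move=> ltnm; rewrite ltnNge; apply/negP => /mmin; rewrite leqNgt ltnm.
exists m; split=> //; case: m mP mlt {mmin} => [|m] mP mlt; first by move: mP; lia.
by have := mlt m (ltnSn m); case: (fS m); lia.
Qed.

Lemma pace_shift (f : nat -> nat) m :
  pace f -> pace (fun n => f (m + n) - f m).
Proof.
move=> pf; have fm := pace_mono pf; case: pf => f0 fS fU; split.
- by rewrite addn0 subnn.
- move=> n; rewrite addnS; have := fm m (m + n) (leq_addr _ _).
  by case: (fS (m + n)) => ->; lia.
- move=> j; have [n Hn] := fU (j + f m); exists n.
  by have := fm n (m + n) (leq_addl _ _); lia.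
Qed.

Definition aligned (S S' : Type) (R : S -> S' -> Prop) (pi : nat -> S)
    (pi' : nat -> S') : Prop :=
  exists f f' : nat -> nat,
    [/\ pace f, pace f' & forall n, R (pi (f n)) (pi' (f' n))].

Lemma aligned_sym (S S' : Type) (R : S -> S' -> Prop) pi pi' :
  aligned R pi pi' -> aligned (fun s' s => R s s') pi' pi.
Proof. by case=> f [f' [pf pf' H]]; exists f', f. Qed.

(** The joint walk first has left position [j] at time [m], and [j'] is the right position then.
    Each [i' < j'] is first reached before [m], when the left position is still below [j]. *)
Lemma aligned_until (S S' : Type) (R : S -> S' -> Prop) pi pi' j :
  aligned R pi pi' -> exists j', aligned R (Defs.suffix pi j) (Defs.suffix pi' j') /\
    forall i', i' < j' -> exists2 i, i < j &
      aligned R (Defs.suffix pi i) (Defs.suffix pi' i').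
Proof.
case=> f [f' [pf pf' H]].
have shift m : aligned R (Defs.suffix pi (f m)) (Defs.suffix pi' (f' m)).
  exists (fun n => f (m + n) - f m), (fun n => f' (m + n) - f' m).
  split; [exact: pace_shift | exact: pace_shift |] => n.
  by rewrite /Defs.suffix !subnKC //; apply: pace_mono => //; exact: leq_addr.
have [m [fm mmin]] := pace_first j pf.
exists (f' m); split; first by rewrite -fm.
move=> i' lti'; have [m' [fm' _]] := pace_first i' pf'.
have lt_m : m' < m.
  by rewrite ltnNge; apply/negP => /(pace_mono pf'); rewrite fm' leqNgt lti'.
by exists (f m'); [exact: mmin | rewrite -fm'].
Qed.

Lemma psat_aligned (AP S A S' A' : Type) (M : lts S A AP) (M' : lts S' A' AP)
    (R : S -> S' -> Prop) d :
  (forall s s', R s s' -> forall f, sdepth f <= d -> (ssat M s f <-> ssat M' s' f)) ->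
  forall p, pdepth p <= d -> forall pi pi', aligned R pi pi' ->
    (psat M pi p <-> psat M' pi' p).
Proof.
move=> HR; elim=> [f|p IH|p IHp q IHq|p IHp q IHq] /=.
- move=> df pi pi' [h [h' [[h0 _ _] [h'0 _ _] H]]].
  by apply: HR => //; have := H 0; rewrite h0 h'0.
- by move=> dp pi pi' al; have := IH dp _ _ al; tauto.
- rewrite geq_max => /andP[dp dq] pi pi' al.
  by have := IHp dp _ _ al; have := IHq dq _ _ al; tauto.
rewrite geq_max => /andP[dp dq] pi pi' al; split=> -[j [Hj Hi]].
- have [j' [alj ali]] := aligned_until j al; exists j'; split.
    exact/(IHq dq _ _ alj).
  by move=> i' /ali[i /Hi ? al']; apply/(IHp dp _ _ al').
- have [j' [/aligned_sym alj ali]] := aligned_until j (aligned_sym al).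
  exists j'; split; first exact/(IHq dq _ _ alj).
  by move=> i' /ali[i /Hi ? /aligned_sym al']; apply/(IHp dp _ _ al').
Qed.

(** * Gluing finite runs into aligned infinite paths *)

Fixpoint nsteps (X : Type) (r : X -> X -> Prop) (n : nat) (x y : X) : Prop :=
  if n is m.+1 then exists2 z, r x z & nsteps r m z y else x = y.

Lemma clos_nsteps (X : Type) (r : X -> X -> Prop) x y :
  clos_refl_trans X r x y -> exists n, nsteps r n x y.
Proof.
move=> xy; have {xy} := clos_rt_rt1n _ _ _ _ xy.
by elim=> [z|a b c rab _ [n IH]]; [exists 0 | exists n.+1, b].
Qed.

(** Dependent choice on points that carry their distance to the next goal. At distance zero the
    level rises and the point stays, hence the stutters. *)
Lemma concat_runs (X : Type) (r : X -> X -> Prop) (C : nat -> X -> Prop) x0 :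
  C 0 x0 ->
  (forall n x, C n x -> exists2 y, clos_refl_trans X r x y & C n.+1 y) ->
  exists xs : nat -> X, [/\ xs 0 = x0,
    forall m, xs m.+1 = xs m \/ r (xs m) (xs m.+1)
    & forall n, exists m, C n (xs m)].
Proof.
move=> C0 CS.
(* A state [(n, x, l)]: current point [x], at distance [l] from a point of [C n]. *)
pose I (c : nat * X * nat) := exists2 y, nsteps r c.2 c.1.2 y & C c.1.1 y.
pose next (c c' : nat * X * nat) :=
  if c.2 is l.+1 then [/\ c'.1.1 = c.1.1, r c.1.2 c'.1.2 & c'.2 = l]
  else c'.1 = (c.1.1.+1, c.1.2).
have nextP c : I c -> exists c', next c c' /\ I c'.
  case: c => [[n x] [|l]] [y /=].
    move=> <- Cx; have [z xz Cz] := CS n x Cx.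
    have {xz} [l xz] := clos_nsteps xz.
    by exists (n.+1, x, l); split=> //; exists z.
  by case=> z rxz zy Cy; exists (n, z, l); split; [split | exists y].
have I0 : I (0, x0, 0) by exists x0.
have [cs [cs0 csP]] := dependent_choice_inv nextP I0.
have reach l m : (cs m).2 = l ->
    (cs (m + l)).1.1 = (cs m).1.1 /\ (cs (m + l)).2 = 0.
  elim: l m => [|l IH] m; first by rewrite addn0.
  move=> El; have [] := csP m; rewrite /next El => -[E1 _ E2] _.
  by have := IH _ E2; rewrite addSnnS E1.
have level n : exists m, (cs m).1.1 = n /\ (cs m).2 = 0.
  elim: n => [|n [m [En E0]]]; first by exists 0; rewrite cs0.
  have [] := csP m; rewrite /next E0 => En1 _.
  have [E1 E2] := reach _ m.+1 erefl.
  by exists (m.+1 + (cs m.+1).2); rewrite E1 En1 /= En.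
exists (fun m => (cs m).1.2); split; first by rewrite cs0.
  move=> m; have [] := csP m; rewrite /next.
  by case: (cs m).2 => [-> _|l [_ ? _] _]; [left | right].
move=> n; have [m [En E0]] := level n; exists m.
by have [_ [y]] := csP m; rewrite E0 /= => ->; rewrite En.
Qed.

Section Build.
Variables (S S' : Type) (T : S' -> S' -> Prop) (R : S -> S' -> Prop).
Variable rho : nat -> S.

(* [(i, s, b)]: position [i] in [rho], current state [s], and the number [b]
   of transitions of [T] taken so far. *)
Definition micro (x y : nat * S' * nat) : Prop :=
  [/\ y.1.1 = x.1.1 \/ y.1.1 = x.1.1.+1,
      (y.1.2 = x.1.2 /\ y.2 = x.2) \/ (T x.1.2 y.1.2 /\ y.2 = x.2.+1)
    & R (rho y.1.1) y.1.2].

Definition runs := clos_refl_trans _ micro.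

Lemma runs_left i s b : R (rho i.+1) s -> runs (i, s, b) (i.+1, s, b).
Proof. by move=> H; apply: rt_step; split; [right | left |]. Qed.

Lemma runs_right i s s' b :
  T s s' -> R (rho i) s' -> runs (i, s, b) (i, s', b.+1).
Proof. by move=> H H'; apply: rt_step; split; [left | right |]. Qed.

Lemma runs_both i s s' b :
  T s s' -> R (rho i.+1) s' -> runs (i, s, b) (i.+1, s', b.+1).
Proof. by move=> H H'; apply: rt_step; split; [right | right |]. Qed.

Lemma runs_trans x y z : runs x y -> runs y z -> runs x z.
Proof. exact: rt_trans. Qed.

(** At the [n]-th checkpoint the position in [rho] is [f n] and at least [h n] transitions of [T]
    have been taken. As [h] is unbounded, an infinite path remains once stutters are removed. *)
Lemma build_aligned (f h : nat -> nat) (C : nat -> S' -> Prop) s0 :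
  f 0 = 0 -> h 0 = 0 -> (forall m, exists n, m <= f n) ->
  (forall m, exists n, m <= h n) -> C 0 s0 -> R (rho 0) s0 ->
  (forall n s b, C n s -> h n <= b -> exists s' b',
     [/\ runs (f n, s, b) (f n.+1, s', b'), C n.+1 s' & h n.+1 <= b']) ->
  exists pi, [/\ forall j, T (pi j) (pi j.+1), pi 0 = s0 & aligned R rho pi].
Proof.
move=> f0 h0 fU hU C0 R0 CS.
pose C' n (x : nat * S' * nat) := [/\ x.1.1 = f n, C n x.1.2 & h n <= x.2].
have C'0 : C' 0 (0, s0, 0) by split; rewrite ?f0 ?h0.
have C'S n x : C' n x -> exists2 y, runs x y & C' n.+1 y.
  case: x => [[i s] b] [/= -> Cn hn]; have [s' [b' [rn Cn' hb]]] := CS n s b Cn hn.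
  by exists (f n.+1, s', b').
have [xs [xs0 xsS xsC]] := concat_runs C'0 C'S.
pose a m := (xs m).1.1; pose st m := (xs m).1.2; pose b m := (xs m).2.
have pa : pace a.
  split; first by rewrite /a xs0.
    by move=> n; rewrite /a; case: (xsS n) => [->|[]]; [left |].
  by move=> m; have [n Hn] := fU m; have [k [Ek _ _]] := xsC n; exists k; rewrite /a Ek.
have bS n : (st n.+1 = st n /\ b n.+1 = b n) \/ (T (st n) (st n.+1) /\ b n.+1 = (b n).+1).
  by rewrite /st /b; case: (xsS n) => [->|[]]; [left |].
have pb : pace b.
  split; first by rewrite /b xs0.
    by move=> n; case: (bS n) => -[_ ->]; [left | right].
  move=> m; have [n Hn] := hU m; have [k [_ _ Hk]] := xsC n; exists k.
  exact: leq_trans Hk.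
have st_const m n : m <= n -> b m = b n -> st m = st n.
  move=> /subnK <-; elim: (n - m) => [//|k IH]; rewrite addSn => Eb.
  have := pace_mono pb (leq_addl k m).
  by case: (bS (k + m)) => -[E1 E2]; rewrite -?Eb -?E2 => ?; [rewrite E1 IH // Eb E2 | lia].
have st_eq m n : b m = b n -> st m = st n.
  by move=> E; case: (leqP m n) => [|/ltnW] le; [| symmetry]; apply: st_const.
(* Sampling at the first moment [mu j] with [j] transitions taken removes the stutters. *)
have [mu muP] := functional_choice_eps (fun j => pace_first j pb).
exists (fun j => st (mu j)); split.
- move=> j; have [Ej jmin] := muP j.+1; case: (mu j.+1) Ej jmin => [|m] Ej jmin.
    by move: Ej; case: pb => ->.
  case: (bS m) => -[E1 E2]; first by have := jmin m (ltnSn m); rewrite -E2 Ej ltnn.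
  by rewrite (st_eq (mu j) m) //; have [-> _] := muP j; lia.
- rewrite (st_eq (mu 0) 0); first by rewrite /st xs0.
  by have [-> _] := muP 0; case: pb.
exists a, b; split=> // n; rewrite (st_eq (mu (b n)) n); last by case: (muP (b n)).
elim: n => [|n IH]; first by rewrite /a /st xs0.
by move: IH; rewrite /a /st; case: (xsS n) => [->|[]].
Qed.

End Build.

(** * Matching paths of finite graphs *)

(** The left side waits at [i] while the right side walks, and advances with the last transition, or
    alone if [j = 0]. *)
Lemma runs_segment (S S' : Type) (T : S' -> S' -> Prop) (R : S -> S' -> Prop)
    (rho : nat -> S) i (tau : nat -> S') j b :
  (forall k, T (tau k) (tau k.+1)) -> (forall k, k < j -> R (rho i) (tau k)) ->
  R (rho i.+1) (tau j) -> runs T R rho (i, tau 0, b) (i.+1, tau j, b + j).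
Proof.
move=> Ttau; case: j => [|j] Hi Hj; first by rewrite addn0; exact: runs_left.
have run k : k <= j -> runs T R rho (i, tau 0, b) (i, tau k, b + k).
  elim: k => [|k IH] kj; first by rewrite addn0; exact: rt_refl.
  apply: runs_trans (IH (ltnW kj)) _; rewrite addnS.
  by apply: runs_right => //; apply: Hi; lia.
by apply: runs_trans (run j (leqnn j)) _; rewrite addnS; exact: runs_both.
Qed.

(** [h n] is the number of events before [n]; it serves as the unbounded count that [build_aligned]
    asks for. *)
Lemma event_counter (P : nat -> Prop) :
  (forall n, exists2 m, n <= m & P m) -> exists h : nat -> nat,
    [/\ h 0 = 0, forall m, exists n, m <= h n
      & forall n, (P n /\ h n.+1 = (h n).+1) \/ (~ P n /\ h n.+1 = h n)].
Proof.
move=> Pinf; have [e eP] : exists e : pred nat, forall i, e i <-> P i.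
  apply: (functional_choice_eps (r := fun i b => is_true b <-> P i)) => i.
  by have [Pi|nPi] := classic (P i); [exists true | exists false].
pose h n := \sum_(i < n) e i.
have hS n : h n.+1 = h n + e n by rewrite /h big_ord_recr.
have h_mono : {homo h : m n / m <= n}.
  apply: homo_leq => // [m n p|n]; first exact: leq_trans.
  by rewrite hS leq_addr.
exists h; split; first by rewrite /h big_ord0.
- elim=> [|m [n Hn]]; first by exists 0.
  have [i lei /eP ei] := Pinf n; exists i.+1.
  by rewrite hS ei addn1 ltnS (leq_trans Hn) ?h_mono.
move=> n; rewrite hS; have := eP n; case: (e n) => en; [left | right].
  by rewrite addn1; split=> //; apply/en.
by rewrite addn0; split=> // /en.
Qed.

(** * Characteristic formulas and Koenig's lemma *)

Definition depth_equiv (AP S A S' A' : Type) (M : lts S A AP) (M' : lts S' A' AP)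
    d s s' : Prop :=
  forall f, sdepth f <= d -> (ssat M s f <-> ssat M' s' f).

(** As [S'] is finite, one conjoins, for each state of [S'] not equivalent to [s], a formula that
    holds in [s] and fails there; negation turns a distinguishing formula the right way round. *)
Lemma characteristic_formula (AP S A A' : Type) (S' : finType)
    (M : lts S A AP) (M' : lts S' A' AP) d s :
  exists chi, [/\ sdepth chi <= d, ssat M s chi
    & forall s', ssat M' s' chi -> depth_equiv M M' d s s'].
Proof.
suff [chi [dc Mc Hc]] : exists chi, [/\ sdepth chi <= d, ssat M s chi
    & forall s', s' \in enum S' -> ssat M' s' chi -> depth_equiv M M' d s s'].
  by exists chi; split=> // s'; apply: Hc; rewrite mem_enum.
elim: (enum S') => [|t l [chi [dc Mc Hc]]]; first by exists STrue.
have [et|net] := classic (depth_equiv M M' d s t).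
  exists chi; split=> // s'; rewrite inE => /predU1P[->//|]; exact: Hc.
have [f [df Mf M'f]] : exists f, [/\ sdepth f <= d, ssat M s f & ~ ssat M' t f].
  apply: NNPP => no; apply: net => f df; split=> Hf; apply: NNPP => nHf; apply: no.
    by exists f.
  by exists (SNot f); split=> //= nf; exact: nf.
exists (SAnd f chi); split=> //=; first by rewrite geq_max df.
by move=> s'; rewrite inE => /predU1P[-> [? _]|s'l [_]] //; exact: Hc.
Qed.

Section Koenig.
Variables (AP A A' : Type) (S S' : finType) (M : lts S A AP) (M' : lts S' A' AP).
Variables (d : nat) (rho : nat -> S).

Lemma two_sided_characteristic_formulas : exists chi : S -> sform AP,
  forall s, [/\ sdepth (chi s) <= d, ssat M s (chi s),
    forall t, ssat M t (chi s) -> depth_equiv M M d s t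
    & forall t, ssat M' t (chi s) -> depth_equiv M M' d s t].
Proof.
suff H s : exists c, [/\ sdepth c <= d, ssat M s c,
    forall t, ssat M t c -> depth_equiv M M d s t
    & forall t, ssat M' t c -> depth_equiv M M' d s t].
  by have [chi chiP] := functional_choice_eps H; exists chi.
have [f [df Mf Hf]] := characteristic_formula M M d s.
have [g [dg Mg Hg]] := characteristic_formula M M' d s.
exists (SAnd f g); split=> //=; first by rewrite geq_max df.
  by move=> t [Ht _]; exact: Hf.
by move=> t [_ Ht]; exact: Hg.
Qed.

(** The path passes through [k] stages, starting with [chi n], after which [base (n + k)] holds. The
    conjunct [chi n] keeps a stage from being skipped when the until is fulfilled at once. *)
Fixpoint stages (chi base : nat -> pform AP) k n : pform AP :=
  if k is k'.+1 then PAnd (chi n) (PUntil (chi n) (stages chi base k' n.+1))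
  else base n.

Lemma stages_depth chi base : (forall n, pdepth (chi n) <= d) ->
  (forall n, pdepth (base n) <= d) -> forall k n, pdepth (stages chi base k n) <= d.
Proof. by move=> dc db; elim=> [|k IH] n //=; rewrite !geq_max dc IH. Qed.

Lemma stages_dec (tau : nat -> S') chi k n :
  psat M' tau (stages chi chi k.+1 n) -> psat M' tau (stages chi chi k n).
Proof.
elim: k n tau => [|k IH] n tau; first by case.
case=> Hc [j [Hj Hi]]; split=> //; exists j; split=> //; exact: IH.
Qed.

(** Each stage takes one transition of [rho]. Paths are compared pointwise, since [sg] is a suffix
    of [rho] only up to extensional equality. *)
Lemma stages_self (chi : S -> sform AP) base :
  (forall s, ssat M s (chi s)) -> forall k n,
  (forall sg, (forall j, sg j = rho (n + k + j)) -> psat M sg (base (n + k))) ->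
  forall sg, (forall j, sg j = rho (n + j)) ->
  psat M sg (stages (fun i => PState (chi (rho i))) base k n).
Proof.
move=> chiP; elim=> [|k IH] n Hb sg Hsg.
  by move: (Hb sg); rewrite addn0 => /(_ Hsg).
split; first by rewrite /= Hsg addn0.
exists 1; split=> [|[|//] _]; last by rewrite /= /Defs.suffix Hsg !addn0.
apply: IH => [sg' Hsg'|j]; last by rewrite /Defs.suffix Hsg add1n addSnnS.
by move: (Hb sg'); rewrite -addSnnS => /(_ Hsg').
Qed.

(** If the class of [rho] is eventually constant, one formula describes the whole path up to
    stuttering. Otherwise formulas describe finite prefixes, Koenig's lemma glues them, and the
    infinitely many changes of class force infinitely many transitions. *)
Lemma koenig_aligned s' :
  (forall p, pdepth p <= d -> psat M rho p ->
     exists tau, [/\ infinite_path M' tau, tau 0 = s' & psat M' tau p]) ->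
  exists tau, [/\ infinite_path M' tau, tau 0 = s'
    & aligned (depth_equiv M M' d) rho tau].
Proof.
move=> H; have [chi chiP] := two_sided_characteristic_formulas.
have chi_self s : ssat M s (chi s) by case: (chiP s).
have chi_M s t : ssat M t (chi s) -> depth_equiv M M d s t by case: (chiP s) => _ _ + _; exact.
have chi_M' s t : ssat M' t (chi s) -> depth_equiv M M' d s t by case: (chiP s) => _ _ _; exact.
have chi_depth s : sdepth (chi s) <= d by case: (chiP s).
pose T u v := exists a, trans M' u a v.
pose chi' n := PState (chi (rho n)).
have unfold_stages base k n tau :
    psat M' tau (stages chi' base k.+1 n) ->
    exists j, [/\ psat M' (Defs.suffix tau j) (stages chi' base k n.+1),
      forall i, i < j -> ssat M' (tau i) (chi (rho n)) & ssat M' (tau 0) (chi (rho n))].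
  move=> [H0 [j [Hj Hi]]]; exists j; split=> // i /Hi.
  by rewrite /= /Defs.suffix addn0.
have path_suffix tau j : infinite_path M' tau -> infinite_path M' (Defs.suffix tau j).
  by move=> ptau i; rewrite /Defs.suffix addnS; exact: ptau.
have [[N const]|nconst] := classic (exists N, forall j, N <= j ->
    depth_equiv M M d (rho N) (rho j)).
(* [base n] says that [chi' n] holds forever. *)
- pose base n := PNot (PUntil (PState STrue) (PNot (chi' n))).
  have baseP tau n : psat M' tau (base n) -> forall j, depth_equiv M M' d (rho n) (tau j).
    move=> Hb j; apply: chi_M'; apply: NNPP => nj; apply: Hb; exists j; split=> //=.
    by rewrite /Defs.suffix addn0.
  pose C n u := exists tau, [/\ infinite_path M' tau, tau 0 = u &
    if n < N then psat M' tau (stages chi' base (N - n) n)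
    else forall j, depth_equiv M M' d (rho N) (tau j)].
  have stagesC n tau : n <= N -> infinite_path M' tau ->
      psat M' tau (stages chi' base (N - n) n) -> C n (tau 0).
    move=> leN ptau Htau; exists tau; split=> //; case: ltnP => // geN.
    have E : n = N by lia.
    by apply: baseP; move: Htau; rewrite E subnn.
  (* Transitions are counted only beyond [N]: before it, a stage may take none. *)
  apply: (@build_aligned _ _ T _ rho id (fun n => n - N) C) => //.
  + by move=> m; exists m.
  + by move=> m; exists (m + N); rewrite addnK.
  + have [||tau [ptau <- Htau]] := H (stages chi' base N 0).
    * by apply: stages_depth => n; rewrite //= max0n.
    * apply: stages_self => // sg Hsg [j []] /=; rewrite /Defs.suffix addn0 Hsg !add0n.
      move=> nj _; apply: nj; apply/(const (N + j)) => //; exact: leq_addr.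
    * by apply: stagesC; rewrite // subn0.
  + have [||tau [_ <- Htau]] := H (chi' 0); [exact: chi_depth | exact: chi_self |].
    exact: chi_M'.
  move=> n s b [tau [ptau Etau]]; case: ltnP => [ltN|geN] Htau hb.
    move: Htau; rewrite -subSS subSn // => Htau.
    have [j [Hj Hi H0]] := unfold_stages _ _ _ _ Htau.
    have := stagesC _ _ ltN (path_suffix tau j ptau) Hj.
    rewrite {1}/Defs.suffix addn0 => Cj.
    exists (tau j), (b + j); rewrite -Etau; split=> //; last by lia.
    apply: runs_segment => // [k /Hi|]; first exact: chi_M'.
    have [sg [psg <- Hsg]] := Cj; move: Hsg; case: ltnP => [ltN'|geN'].
      by move=> Hsg; apply: chi_M'; move: Hsg; rewrite -subSS subSn // => -[].
    by have -> : n.+1 = N by [lia]; move/(_ 0).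
  exists (tau 1), b.+1; rewrite -Etau; split; last by lia.
    apply: runs_both => // f df.
    by rewrite -(const n.+1 (leqW geN) f df); exact: Htau.
  exists (Defs.suffix tau 1); split=> //; first exact: path_suffix.
  by rewrite ltnNge (leqW geN) /= => j; exact: Htau.
(* From [u], any finite number of further classes of [rho] can be realised, by a path that may
   depend on [m]. *)
pose C n u := forall m, exists tau, [/\ infinite_path M' tau, tau 0 = u &
  psat M' tau (stages chi' chi' m n)].
have changes n : exists2 i, n <= i & ~ depth_equiv M M d (rho i) (rho i.+1).
  apply: NNPP => no; apply: nconst; exists n => j /subnK <-.
  elim: (j - n) => [//|k IH] f df; rewrite IH // addSn.
  have : depth_equiv M M d (rho (k + n)) (rho (k + n).+1); last exact.
  by apply: NNPP => ck; apply: no; exists (k + n); rewrite ?leq_addl.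
have [h [h0 hU hS]] := event_counter changes.
have C_equiv n u : C n u -> depth_equiv M M' d (rho n) u.
  by case/(_ 0) => tau [_ <- Htau]; exact: chi_M'.
have C0 : C 0 s'.
  move=> m; apply: H; first by apply: stages_depth => n /=.
  by apply: stages_self => // sg Hsg /=; rewrite Hsg addn0.
apply: (@build_aligned _ _ T _ rho id h C) => //.
- by move=> m; exists m.
- exact: C_equiv.
move=> n u b Cu hb.
(* [v] ends the [n]-th stage and allows [m] more. Finiteness of [S'] and monotonicity in [m] yield
   one [v] for all [m]. *)
pose Q m v := exists tau j, [/\ infinite_path M' tau, tau 0 = u, tau j = v,
  forall i, i < j -> ssat M' (tau i) (chi (rho n))
  & psat M' (Defs.suffix tau j) (stages chi' chi' m n.+1)].
have [v Qv] : exists v, forall m, Q m v.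
  apply: pigeonhole_decreasing => [m v [tau [j [? ? ? ? Hj]]]|m].
    by exists tau, j; split=> //; exact: stages_dec.
  have [tau [ptau Etau Htau]] := Cu m.+1.
  by have [j [Hj Hi _]] := unfold_stages _ _ _ _ Htau; exists (tau j), tau, j.
have Cv : C n.+1 v.
  move=> m; have [tau [j [ptau _ Ev _ Hj]]] := Qv m; exists (Defs.suffix tau j).
  by split=> //; [exact: path_suffix | rewrite /Defs.suffix addn0].
have [tau [j [ptau Eu Ev Hi _]]] := Qv 0.
exists v, (b + j); split=> //.
  rewrite -Eu -Ev; apply: runs_segment => // [k /Hi|]; first exact: chi_M'.
  by rewrite Ev; exact: C_equiv.
(* Where the class changes, [j = 0] is impossible: [u] would lie in two classes. *)
case: (hS n) => -[En ->]; last exact: leq_trans (leq_addr _ _).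
case: j Ev {Hi} => [Ev|j _]; last by lia.
case: En => f df; have Euv : u = v by rewrite -Eu Ev.
by rewrite (C_equiv _ _ Cu f df) (C_equiv _ _ Cv f df) Euv.
Qed.

End Koenig.

Lemma lazy_path_aligned (AP S A : Type) (M : lts S A AP) (rho : nat -> S) :
  (forall n, rho n.+1 = rho n \/ exists a, trans M (rho n) a (rho n.+1)) ->
  (forall n, exists2 m, n <= m & rho m.+1 <> rho m) ->
  exists tau, [/\ infinite_path M tau, tau 0 = rho 0 & aligned eq rho tau].
Proof.
move=> rhoS moves.
have [h [h0 hU hS]] := event_counter moves.
apply: (@build_aligned _ _ (fun u v => exists a, trans M u a v) _ rho id h
  (fun n u => u = rho n)) => //; first by move=> m; exists m.
move=> n s b -> hb; exists (rho n.+1).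
case: (hS n) (rhoS n) => -[En ->] => [|_].
  by case=> // Tn; exists b.+1; split=> //; exact: runs_both.
have {}En : rho n.+1 = rho n by apply: NNPP.
by exists b; split=> //; rewrite -En; exact: runs_left.
Qed.

(** * Token-passing systems *)

Section Template.
Variables (Sint : finType) (AP : Type) (P : template Sint AP).

Definition int_step (q q' : pstate P) : Prop := exists a, trans P q (Int a) q'.

(** By [alternateP] the actions split into blocks, and already the first one contains a send and a
    receive. *)
Lemma no_infinite_int_run (q : nat -> pstate P) :
  ~ forall i, int_step (q i) (q i.+1).
Proof.
move=> /functional_choice_eps[alpha Halpha].
have noblock a b : ~~ is_int a -> ~ omega_power (block a b) (fun i => Int (alpha i)).
  move=> inta [c [_ _ /(_ 0) [u [v [_ _ E]]]]].
  have : all (@is_int Sint) (u ++ a :: v ++ [:: b]) by rewrite -E all_map; apply/allP.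
  by rewrite all_cat /= (negbTE inta) andbF.
by have [] := alternateP Halpha; apply: noblock.
Qed.

Definition ready (q : pstate P) : Prop :=
  exists q', trans P q (if token q then Snd else Rcv) q'.

(** Every state has a successor, and a state that is not ready has only internal ones. Never
    reaching a ready state would thus give an infinite internal run. *)
Lemma reach_ready q : exists2 q', clos_refl_trans _ int_step q q' & ready q'.
Proof.
apply: NNPP => no.
pose I x := ~ exists2 q', clos_refl_trans _ int_step x q' & ready q'.
have IS x : I x -> exists y, int_step x y /\ I y.
  move=> Ix; have [a [y]] := totalP x; case: a => [a||] xy.
  - exists y; split; first by exists a.
    case=> z yz rz; apply: Ix; exists z => //.
    by apply: rt_trans yz; apply: rt_step; exists a.
  - case: Ix; exists x; first exact: rt_refl.
    by exists y; have [-> _] := sndP xy.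
  - case: Ix; exists x; first exact: rt_refl.
    by exists y; have [/negbTE -> _] := rcvP xy.
have [qs [_ qsP]] := dependent_choice_inv IS no.
by apply: (@no_infinite_int_run qs) => i; case: (qsP i).
Qed.

Section System.
Variable G : topology.
Implicit Types (s : {ffun vertex G -> pstate P}) (u v w : vertex G).

Definition sys_step s s' : Prop := exists a, sys_trans s a s'.

Definition holder s v : Prop := forall u, token (s u) = (u == v).

Definition upd s w q : {ffun vertex G -> pstate P} :=
  [ffun u => if u == w then q else s u].

Lemma holder_inj s v w : holder s v -> holder s w -> v = w.
Proof. by move=> /(_ v) Hv /(_ v); rewrite Hv eqxx => /esym/eqP. Qed.

Lemma edge_neq v w : edge v w -> v != w.
Proof. by apply: contraL => /eqP ->; rewrite edge_irr. Qed.

Lemma holder_int_step s w q v : holder s v -> int_step (s w) q -> holder (upd s w q) v.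
Proof.
move=> Hs [a /intP Eq] u; rewrite ffunE; case: eqP => [->|_]; last exact: Hs.
by rewrite -Eq.
Qed.

Lemma sys_int_step s w q : int_step (s w) q -> sys_step s (upd s w q).
Proof.
move=> [a Ha]; exists (SysInt a), w; rewrite ffunE eqxx; split=> // u.
by rewrite ffunE => /negbTE ->.
Qed.

Lemma sys_stepP s s' v : holder s v -> sys_step s s' ->
  (exists w, [/\ int_step (s w) (s' w), forall u, u != w -> s' u = s u & holder s' v])
  \/ (exists w, [/\ edge v w, trans P (s v) Snd (s' v), trans P (s w) Rcv (s' w),
        forall u, u != v -> u != w -> s' u = s u & holder s' w]).
Proof.
move=> Hs [[b|] H]; [left | right].
  move: H => [w [Hw Ho]]; exists w; split=> //; first by exists b.
  move=> u; case: (eqVneq u w) => [->|/Ho -> //].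
  by rewrite -(intP Hw).
move: H => [v' [w [Evw Hv Hw Ho]]].
have [tv ntv] := sndP Hv; have [ntw tw] := rcvP Hw.
have Ev : v' = v by apply/eqP; rewrite -Hs.
move: Evw Hv Ho tv ntv; rewrite {}Ev => Evw Hv Ho tv ntv; exists w; split=> // u.
have [->|uw] := eqVneq u w; first by rewrite tw.
have [->|uv] := eqVneq u v; first by rewrite (negbTE ntv).
by rewrite Ho // Hs (negbTE uv).
Qed.

(** If the token rested from [n] on, all later steps would be internal, and one of the finitely many
    processes would move infinitely often. *)
Lemma holder_moves (pi : nat -> {ffun vertex G -> pstate P}) (rho : nat -> vertex G) :
  (forall n, sys_step (pi n) (pi n.+1)) -> (forall n, holder (pi n) (rho n)) ->
  forall n, exists2 m, n <= m & rho m.+1 <> rho m.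
Proof.
move=> ppi Hrho n; apply: NNPP => still.
pose moved v m := int_step (pi m v) (pi m.+1 v).
have mover m : n <= m -> exists v, moved v m /\ forall u, u != v -> pi m.+1 u = pi m u.
  move=> nm; case: (sys_stepP (Hrho m) (ppi m)) => -[w]; first by case=> H1 H2 _; exists w.
  case=> /edge_neq vw _ _ _ Hw; case: still; exists m => // E.
  by move/eqP: vw; apply; rewrite -E; exact: holder_inj Hw.
have [v vinf] : exists v, forall N, exists2 m, N <= m & n <= m /\ moved v m.
  apply: NNPP => no.
  have H v : exists N, forall m, N <= m -> n <= m -> ~ moved v m.
    apply: NNPP => H; apply: no; exists v => N; apply: NNPP => H'; apply: H.
    by exists N => m Nm nm mv; apply: H'; exists m.
  have [N HN] := functional_choice_eps H.
  have [v [mv _]] := mover (n + \max_v N v) (leq_addr _ _).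
  apply: (HN v) mv; last exact: leq_addr.
  exact: leq_trans (leq_bigmax v) (leq_addl _ _).
pose I m := n <= m /\ moved v m.
(* Steps of other processes leave the state of [v] unchanged, so the moves of [v] chain into one run
   of the template. *)
have next l m : n <= m -> I (m + l) -> exists m', I m' /\ pi m' v = pi m v.
  elim: l m => [|l IH] m nm; first by rewrite addn0; exists m.
  have [mv _|nmv] := classic (moved v m); first by exists m.
  rewrite -addSnnS => /(IH _ (leqW nm)) [m' [Im' E]]; exists m'; split=> //.
  have [w [mw ho]] := mover m nm; rewrite E; apply: ho.
  by apply: contra_notN nmv => /eqP ->.
have IS m : I m -> exists m', int_step (pi m v) (pi m' v) /\ I m'.
  case=> nm mv; have [m2 le2 Im2] := vinf m.+1.
  have [|m' [Im' E]] := next (m2 - m.+1) m.+1 (leqW nm); first by rewrite subnKC.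
  by exists m'; split=> //; rewrite E.
have [m0 _ Im0] := vinf 0.
have [ms [_ msP]] := dependent_choice_inv IS Im0.
by apply: (@no_infinite_int_run (fun i => pi (ms i) v)) => i; case: (msP i).
Qed.

(** * Passing the token with visible and hidden processes *)

Section Visible.
Variables (S : Type) (R : S -> {ffun vertex G -> pstate P} -> Prop) (rho : nat -> S).
Variables (k : nat) (g : k.-tuple (vertex G)).

Definition shows s (x : 'I_k -> pstate P) : Prop := forall j, s (tnth g j) = x j.

Let sruns := runs sys_step R rho.

Lemma prepare_hidden i s v w b : holder s v ->
  (forall s1, holder s1 v -> (forall u, u != w -> s1 u = s u) -> R (rho i) s1) ->
  exists s1 b', [/\ sruns (i, s, b) (i, s1, b'), b <= b', holder s1 v,
    forall u, u != w -> s1 u = s u & ready (s1 w)].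
Proof.
have [q1 run rq] := reach_ready (s w).
have {run} := clos_rt_rt1n _ _ _ _ run; move Eq: (s w) => q run.
elim: run rq s b Eq => {q q1} [q|q q2 q1 qq2 _ IH] rq s b Eq Hs HR.
  by exists s, b; split=> //; [exact: rt_refl | rewrite Eq].
rewrite -Eq in qq2; have Hs' := holder_int_step Hs qq2.
have Ho u : u != w -> upd s w q2 u = s u by rewrite ffunE => /negbTE ->.
have [] := IH rq (upd s w q2) b.+1 => //; first by rewrite ffunE eqxx.
  by move=> s1 H1 H2; apply: HR => // u uw; rewrite H2 // Ho.
move=> s1 [b' [r1 lb H1 H2 H3]]; exists s1, b'; split=> //; last first.
- by move=> u uw; rewrite H2 // Ho.
- exact: ltnW.
apply: runs_trans r1; apply: runs_right; first exact: sys_int_step.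
by apply: HR.
Qed.

Definition pass_action u w : action Sint := if w == u then Snd else Rcv.

Definition can_pass s u w (y : 'I_k -> pstate P) : Prop :=
  exists q, trans P (s w) (pass_action u w) q /\ forall j, w = tnth g j -> y j = q.

(** Only a hidden process is run to readiness; a visible one must be able to act at once, since its
    state may not change. *)
Lemma prepare i s u w b x y : holder s u -> shows s x ->
  (forall s1, holder s1 u -> shows s1 x -> R (rho i) s1) ->
  ((exists j, w = tnth g j) -> can_pass s u w y) ->
  exists s1 b', [/\ sruns (i, s, b) (i, s1, b'), b <= b', holder s1 u,
    shows s1 x & (forall v, v != w -> s1 v = s v) /\ can_pass s1 u w y].
Proof.
move=> Hs Hx HR Hw; have [wg|nwg] := classic (exists j, w = tnth g j).
  by exists s, b; split=> //; [exact: rt_refl | split=> //; exact: Hw].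
have showsP s1 : (forall v, v != w -> s1 v = s v) -> shows s1 x.
  by move=> H j; rewrite H ?Hx //; apply/eqP => E; apply: nwg; exists j.
have [|s1 [b' [r1 lb H1 H2 [q Hq]]]] := @prepare_hidden i s u w b Hs.
  by move=> s1 H1 /showsP; exact: HR.
exists s1, b'; split=> //; first exact: showsP.
split=> //; exists q; rewrite /pass_action -(H1 w); split=> // j E.
by case: nwg; exists j.
Qed.

(** Sender and receiver are made ready in turn. The step from [s1] to [s2] stays outside the run
    because the left side may wait during it or move with it. *)
Lemma pass_token i s u w b x y : holder s u -> shows s x -> edge u w ->
  (forall s1, holder s1 u -> shows s1 x -> R (rho i) s1) ->
  ((exists j, u = tnth g j) -> can_pass s u u y) ->
  ((exists j, w = tnth g j) -> can_pass s u w y) ->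
  (forall j, tnth g j != u -> tnth g j != w -> y j = x j) ->
  exists s1 s2 b', [/\ sruns (i, s, b) (i, s1, b'), b <= b', sys_step s1 s2,
    holder s2 w & shows s2 y].
Proof.
move=> Hs Hx euw HR Hu Hw Ho; have uw := edge_neq euw.
have wu : w != u by rewrite eq_sym.
have [s1 [b1 [r1 lb1 H1 S1 [O1 C1]]]] := prepare b Hs Hx HR Hu.
have Hw1 : (exists j, w = tnth g j) -> can_pass s1 u w y.
  by rewrite /can_pass O1.
have [s2 [b2 [r2 lb2 H2 S2 [O2 [qw [tw yw]]]]]] := prepare b1 H1 S1 HR Hw1.
case: C1 => qu [tu yu]; rewrite -O2 // in tu.
move: tu tw; rewrite /pass_action eqxx (negbTE wu) => tu tw.
pose s3 := upd (upd s2 u qu) w qw.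
have Eu : s3 u = qu by rewrite !ffunE (negbTE uw) eqxx.
have Ew : s3 w = qw by rewrite !ffunE eqxx.
have Eo v : v != u -> v != w -> s3 v = s2 v.
  by rewrite !ffunE => /negbTE -> /negbTE ->.
exists s2, s3, b2; split.
- exact: runs_trans r1 r2.
- exact: leq_trans lb2.
- by exists (@SysTok Sint), u, w; rewrite Eu Ew.
- move=> v; have [->|vw] := eqVneq v w; first by rewrite Ew; have [_ ->] := rcvP tw.
  have [->|vu] := eqVneq v u; first by rewrite Eu; have [_ /negbTE ->] := sndP tu.
  by rewrite Eo // H2 (negbTE vu).
move=> j; have [E|jw] := eqVneq (tnth g j) w; first by rewrite E Ew (yw j).
have [E|ju] := eqVneq (tnth g j) u; first by rewrite E Eu (yu j).
by rewrite Eo // S2 Ho.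
Qed.

End Visible.
End System.
End Template.

(** * Simulation between two token-passing systems *)

Lemma depth_equiv_sym (AP S A S' A' : Type) (M : lts S A AP) (M' : lts S' A' AP)
    d s s' : depth_equiv M M' d s s' -> depth_equiv M' M d s' s.
Proof. by move=> H f df; have := H f df; tauto. Qed.

Lemma depth_equiv_ind (AP S A S' A' : Type) (M : lts S A AP) (M' : lts S' A' AP)
    d s s' :
  (forall a, label M s a <-> label M' s' a) ->
  (forall p, pdepth p < d -> (ssat M s (SE p) <-> ssat M' s' (SE p))) ->
  depth_equiv M M' d s s'.
Proof.
move=> Hlab HE; elim=> [|a|f IHf|f IHf h IHh|p] //= df; last exact: HE.
- by have := IHf df; tauto.
- by move: df; rewrite geq_max => /andP[/IHf ? /IHh ?]; tauto.
Qed.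

Section Simulation.
Variables (Sint : finType) (AP : Type) (P : template Sint AP) (k : nat).

Definition state_equiv (G G' : topology) (g : k.-tuple (vertex G))
    (g' : k.-tuple (vertex G')) d
    (s : {ffun vertex G -> pstate P}) (s' : {ffun vertex G' -> pstate P}) : Prop :=
  exists v v', [/\ holder s v, holder s' v',
    depth_equiv (graph_lts g) (graph_lts g') d v v'
    & shows g' s' (fun j => s (tnth g j))].

Lemma state_equiv_sym G G' (g : k.-tuple (vertex G)) (g' : k.-tuple (vertex G'))
    d s s' : state_equiv g g' d s s' -> state_equiv g' g d s' s.
Proof.
move=> [v [v' [Hv Hv' Hd Hs]]]; exists v', v; split=> //; exact: depth_equiv_sym.
Qed.

Section Step.
Variables (G G' : topology) (g : k.-tuple (vertex G)) (g' : k.-tuple (vertex G')).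
Hypotheses (hg : uniq g) (hg' : uniq g').
Variable d : nat.
Variables (pi : nat -> {ffun vertex G -> pstate P}) (rho : nat -> vertex G).
Hypothesis pi_path : forall n, sys_step (pi n) (pi n.+1).
Hypothesis pi_holder : forall n, holder (pi n) (rho n).

Let deq := depth_equiv (graph_lts g) (graph_lts g') d.
Let gruns := runs (@sys_step Sint AP P G') (state_equiv g g' d) pi.
Let vis i j := pi i (tnth g j).

Lemma deq_mark v v' j : deq v v' -> v = tnth g j <-> v' = tnth g' j.
Proof. by move=> H; have := H (SAtom j) (leq0n d). Qed.

Lemma tnth_eq (K : topology) (t : k.-tuple (vertex K)) i j :
  uniq t -> (tnth t i == tnth t j) = (i == j).
Proof. by move=> /tuple_uniqP /inj_eq ->. Qed.

Lemma state_equivI i s u : deq (rho i) u -> holder s u -> shows g' s (vis i) ->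
  state_equiv g g' d (pi i) s.
Proof. by move=> Hd Hs Hx; exists (rho i), u. Qed.

(** An internal step of a visible process is copied, one of a hidden process ignored. If the token
    is passed, both ends are equivalent to [u], hence unmarked, and nothing visible changes. *)
Lemma follow_left i s u b : deq (rho i) u -> deq (rho i.+1) u -> holder s u ->
  shows g' s (vis i) ->
  exists s' b', [/\ gruns (i, s, b) (i.+1, s', b'), b <= b', holder s' u
    & shows g' s' (vis i.+1)].
Proof.
move=> d0 d1 Hs Hx.
have keep : (forall j, vis i.+1 j = vis i j) -> exists s' b',
    [/\ gruns (i, s, b) (i.+1, s', b'), b <= b', holder s' u & shows g' s' (vis i.+1)].
  move=> E; have Hx1 : shows g' s (vis i.+1) by move=> j; rewrite E.
  by exists s, b; split=> //; apply: runs_left; exact: state_equivI d1 Hs Hx1.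
case: (sys_stepP (pi_holder i) (pi_path i)) => -[w].
  case=> Hw Ho _; have [[j0 Ej]|nw] := classic (exists j, w = tnth g j); last first.
    by apply: keep => j; rewrite /vis Ho //; apply/eqP => E; apply: nw; exists j.
  have Hst : int_step (s (tnth g' j0)) (pi i.+1 w) by rewrite Hx /vis -Ej.
  have Hs' := holder_int_step Hs Hst.
  have Hx' : shows g' (upd s (tnth g' j0) (pi i.+1 w)) (vis i.+1).
    move=> j; rewrite ffunE tnth_eq //; case: eqP => [->|/eqP jj0].
      by rewrite /vis -Ej.
    by rewrite Hx /vis Ho // Ej tnth_eq.
  exists (upd s (tnth g' j0) (pi i.+1 w)), b.+1; split=> //.
  by apply: runs_both; [exact: sys_int_step | exact: state_equivI d1 Hs' Hx'].
case=> ew _ _ Ho Hw; have Ew : rho i.+1 = w := holder_inj (pi_holder _) Hw.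
(* A mark on one end would, through [u], also lie on the other, but an edge has distinct ends. *)
rewrite Ew in d1; apply: keep => j; have nw := edge_neq ew.
apply: Ho; apply/eqP => E; move/eqP: nw; apply.
  by rewrite -E; apply/esym/(deq_mark j d1)/(deq_mark j d0).
by rewrite -E; apply/(deq_mark j d0)/(deq_mark j d1).
Qed.

(** Both [u] and [w] are equivalent to [rho i], so they share their marks; being distinct they have
    none and can be run to readiness. *)
Lemma follow_right i s u w b : deq (rho i) u -> deq (rho i) w -> edge u w ->
  holder s u -> shows g' s (vis i) ->
  exists s' b', [/\ gruns (i, s, b) (i, s', b'), b < b', holder s' w
    & shows g' s' (vis i)].
Proof.
move=> d0 d1 euw Hs Hx; have /eqP uw := edge_neq euw.
have [||//|s1 [s2 [b1 [r1 lb st H2 S2]]]] :=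
  @pass_token _ _ _ _ _ (state_equiv g g' d) pi _ g' i s u w b _ (vis i) Hs Hx euw
    (fun s1 => @state_equivI i s1 u d0).
- by case=> j E; case: uw; rewrite ((deq_mark j d1).1 ((deq_mark j d0).2 E)).
- by case=> j E; case: uw; rewrite ((deq_mark j d0).1 ((deq_mark j d1).2 E)).
exists s2, b1.+1; split=> //; apply: runs_trans r1 _.
by apply: runs_right => //; exact: state_equivI d1 H2 S2.
Qed.

(** Since the holder changes, the step of [pi] passes the token. [u] and [w] carry the marks of
    [rho i] and [rho i.+1], so visible ends copy their counterparts. *)
Lemma follow_both i s u w b : deq (rho i) u -> deq (rho i.+1) w ->
  rho i.+1 <> rho i -> edge u w -> holder s u -> shows g' s (vis i) ->
  exists s' b', [/\ gruns (i, s, b) (i.+1, s', b'), b < b', holder s' w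
    & shows g' s' (vis i.+1)].
Proof.
move=> d0 d1 mv euw Hs Hx.
case: (sys_stepP (pi_holder i) (pi_path i)) => -[z].
  by case=> _ _ /(holder_inj (pi_holder _)) E; case: mv.
case=> ez Hv Hz Ho /(holder_inj (pi_holder _)) Ez; rewrite -{}Ez in ez Hz Ho.
have wu : (w == u) = false by rewrite eq_sym; exact/negbTE/edge_neq.
have [|||s1 [s2 [b1 [r1 lb st H2 S2]]]] :=
  @pass_token _ _ _ _ _ (state_equiv g g' d) pi _ g' i s u w b _ (vis i.+1) Hs Hx euw
    (fun s1 => @state_equivI i s1 u d0).
- case=> j0 E; have Ej := (deq_mark j0 d0).2 E.
  exists (pi i.+1 (rho i)); rewrite /pass_action eqxx {1}E Hx /vis -Ej; split=> // j Ej'.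
  by rewrite -(deq_mark j d0).2.
- case=> j0 E; have Ej := (deq_mark j0 d1).2 E.
  exists (pi i.+1 (rho i.+1)); rewrite /pass_action wu {1}E Hx /vis -Ej; split=> // j Ej'.
  by rewrite -(deq_mark j d1).2.
- move=> j ju jw; apply: Ho.
    by apply: contraNneq ju => E; apply/eqP/esym/(deq_mark j d0).
  by apply: contraNneq jw => E; apply/eqP/esym/(deq_mark j d1).
exists s2, b1.+1; split=> //; apply: runs_trans r1 _.
by apply: runs_both => //; exact: state_equivI d1 H2 S2.
Qed.

Lemma follow_path s0 (tau : nat -> vertex G') :
  (forall n, edge (tau n) (tau n.+1)) -> aligned deq rho tau ->
  holder s0 (tau 0) -> shows g' s0 (vis 0) ->
  exists pi', [/\ forall n, sys_step (pi' n) (pi' n.+1), pi' 0 = s0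
    & aligned (state_equiv g g' d) pi pi'].
Proof.
move=> etau [f [f' [[f0 fS fU] [f'0 f'S f'U] al]]] H0 S0.
pose C n s := holder s (tau (f' n)) /\ shows g' s (vis (f n)).
apply: (@build_aligned _ _ _ _ _ f f' C) => //.
- by rewrite /C f0 f'0.
- by apply: state_equivI H0 S0; have := al 0; rewrite f0 f'0.
move=> n s b [Hs Hx] hb; rewrite /C; move: (al n) (al n.+1).
have weaken (b' : nat) : b < b' -> (f' n).+1 <= b' by apply: leq_ltn_trans.
case: (f'S n) => ->; case: (fS n) => -> d0 d1.
- by exists s, b; split=> //; exact: rt_refl.
- have [s' [b' [r lb H1 S1]]] := follow_left b d0 d1 Hs Hx.
  by exists s', b'; split=> //; exact: leq_trans lb.
- have [s' [b' [r lb H1 S1]]] := follow_right b d0 d1 (etau _) Hs Hx.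
  by exists s', b'; split=> //; exact: weaken.
(* If both positions advance but the holder in [pi] does not change, the two sides move one after
   the other. *)
have [E|mv] := eqVneq (rho (f n).+1) (rho (f n)); last first.
  have [s' [b' [r lb H1 S1]]] := follow_both b d0 d1 (elimN eqP mv) (etau _) Hs Hx.
  by exists s', b'; split=> //; exact: weaken.
have d01 := d0; rewrite -E in d01.
have [s1 [b1 [r1 lb1 H1 S1]]] := follow_left b d0 d01 Hs Hx.
have [s2 [b2 [r2 lb2 H2 S2]]] := follow_right b1 d01 d1 (etau _) H1 S1.
exists s2, b2; split=> //; first exact: runs_trans r1 r2.
by apply: weaken; exact: leq_ltn_trans lb2.
Qed.

End Step.

(** [rho] may stutter and need not be a graph path, so its formulas are witnessed by the aligned
    path [tau]. Equivalence at depth [d.+1] transfers each [SE p] with [p] of depth at most [d] to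
    [v'], and [koenig_aligned] merges the resulting paths into one. *)
Lemma simulate_path G G' (g : k.-tuple (vertex G)) (g' : k.-tuple (vertex G'))
    d s s' pi : uniq g -> uniq g' -> state_equiv g g' d.+1 s s' ->
  infinite_path (projection P g) pi -> pi 0 = s ->
  exists pi', [/\ infinite_path (projection P g') pi', pi' 0 = s'
    & aligned (state_equiv g g' d) pi pi'].
Proof.
move=> ug ug' [v [v' [Hv Hv' Hd Hs]]] ppi pi0.
have [rho Hrho] : exists rho, forall n, holder (pi n) (rho n).
  apply: (functional_choice_eps (r := fun n => holder (pi n))).
  elim=> [|n [u Hu]]; first by exists v; rewrite pi0.
  by case: (sys_stepP Hu (ppi n)) => -[w]; case=> *; [exists u | exists w].
have rho0 : rho 0 = v by apply: holder_inj (Hrho 0) _; rewrite pi0.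
have lazy n : rho n.+1 = rho n \/ exists a, trans (graph_lts g) (rho n) a (rho n.+1).
  case: (sys_stepP (Hrho n) (ppi n)) => -[w].
    by case=> _ _ Hn; left; exact: holder_inj (Hrho _) Hn.
  by case=> e _ _ _ Hn; right; exists tt; rewrite (holder_inj (Hrho _) Hn).
have [tau [ptau tau0 al]] := lazy_path_aligned lazy (holder_moves ppi Hrho).
have [|tau' [ptau' tau'0 al']] := @koenig_aligned _ _ _ _ _
    (graph_lts g) (graph_lts g') d rho v'.
  move=> p dp Hp; have [+ _] := Hd (SE p) dp; apply.
  exists tau; rewrite tau0 rho0; split=> //; apply/(psat_aligned (M := graph_lts g) _ dp al) => //.
  by move=> t t' ->.
apply: (follow_path ug ug' ppi Hrho _ al'); rewrite ?tau'0 //.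
- by move=> n; case: (ptau' n).
- by move=> j; rewrite Hs pi0.
Qed.

(** Each path quantifier uses up one level of [d]. The induction generalises the graphs because the
    converse direction exchanges them. *)
Lemma state_equiv_sat d G G' (g : k.-tuple (vertex G)) (g' : k.-tuple (vertex G'))
    s s' : uniq g -> uniq g' -> state_equiv g g' d s s' ->
  depth_equiv (projection P g) (projection P g') d s s'.
Proof.
elim: d G G' g g' s s' => [|d IH] G G' g g' s s' ug ug' H.
all: have [v [v' [_ _ _ Hs]]] := H.
all: apply: depth_equiv_ind => [[p j]|p]; rewrite /= ?Hs //.
move=> dp; split=> -[pi [ppi pi0 Hp]].
- have [pi' [ppi' pi'0 al]] := simulate_path ug ug' H ppi pi0.
  have Hsat := psat_aligned (fun t t' => IH _ _ g g' t t' ug ug') dp al.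
  by exists pi'; split=> //; exact/Hsat.
- have [pi' [ppi' pi'0 al]] := simulate_path ug' ug (state_equiv_sym H) ppi pi0.
  have Hsat := psat_aligned (fun t t' => IH _ _ g' g t t' ug' ug) dp al.
  by exists pi'; split=> //; exact/Hsat.
Qed.

End Simulation.

Theorem theorem6 (Sint : finType) (hSint : 0 < #|Sint|) (AP : Type)
    (d k : nat) (G G' : topology) (P : template Sint AP)
    (g : k.-tuple (vertex G)) (g' : k.-tuple (vertex G'))
    (hg : uniq g) (hg' : uniq g') :
  ctls_equiv d (graph_lts g) (graph_lts g') ->
  ctls_equiv d (projection P g) (projection P g').
Proof.
move=> H.
have start_equiv : depth_equiv (graph_lts g) (graph_lts g') d (start G) (start G').
  move=> f df; have := H f df; rewrite /models /= => E.
  by split=> Hf; [apply: E.1 | apply: E.2] => // _ ->.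
pose s0 K : {ffun vertex K -> pstate P} :=
  [ffun v => if v == start K then iota_t P else iota_n P].
have holder0 K : holder (s0 K) (start K).
  move=> v; rewrite ffunE; case: eqP => _; first exact: iota_tP.
  exact/negbTE/iota_nP.
have E0 : state_equiv g g' d (s0 G) (s0 G').
  exists (start G), (start G'); split=> // j; rewrite !ffunE.
  (* The atom [j] at the start vertex tells whether the visible process [j] starts with the
     token. *)
  have := start_equiv (SAtom j) (leq0n d); rewrite /= => -[E1 E2].
  by congr (if _ then _ else _); apply/eqP/eqP => /esym ?; apply/esym; auto.
have Hsat := state_equiv_sat hg hg' E0.
move=> f df; have := Hsat f df; rewrite /models /= => E.
by split=> Hf s ->; apply/E; exact: Hf.
Qed.
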